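(* Let $(\mathfrak{g},[\cdot,\cdot],\alpha)$ be a regular hom-Lie algebra, $(V,\beta,\rho)$ a representation with $\beta$ invertible, and $T:V\to\mathfrak{g}$ an $\mathcal{O}$-operator on $(\mathfrak{g},[\cdot,\cdot],\alpha)$ with respect to $(V,\beta,\rho)$. If $T_t=T+\sum_{i\ge1}t^iT_i$ and $\overline{T}_t=T+\sum_{i\ge1}t^i\overline{T}_i$ are equivalent formal deformations of $T$, then their infinitesimals $T_1$ and $\overline{T}_1$ belong to the same cohomology class in $\widetilde{H}^1_{\beta,\alpha}(V,\mathfrak{g})$.
   Context: The base field $k$ has characteristic zero. A (multiplicative) hom-Lie algebra $(\mathfrak{g},[\cdot,\cdot],\alpha)$ is a vector space $\mathfrak{g}$ with a skew-symmetric bilinear bracket and a linear map $\alpha:\mathfrak{g}\to\mathfrak{g}$ with $\alpha[x,y]=[\alpha(x),\alpha(y)]$ and $[\alpha(x),[y,z]]+[\alpha(y),[z,x]]+[\alpha(z),[x,y]]=0$; it is regular if $\alpha$ is invertible. A representation $(V,\beta,\rho)$ is a vector space $V$, $\beta\in\mathrm{End}(V)$ and a linear map $\rho:\mathfrak{g}\to\mathrm{End}(V)$ with $\rho(\alpha(x))(\beta(v))=\beta(\rho(x)(v))$ and $\rho([x,y])(\beta(v))=\rho(\alpha(x))\rho(y)(v)-\rho(\alpha(y))\rho(x)(v)$. Write $\{x,v\}:=\rho(x)(v)$. An $\mathcal{O}$-operator on $(\mathfrak{g},[\cdot,\cdot],\alpha)$ with respect to $(V,\beta,\rho)$ is a linear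 map $T:V\to\mathfrak{g}$ with $T\circ\beta=\alpha\circ T$ and $[Tu,Tv]=T(\{Tu,v\}-\{Tv,u\})$ for all $u,v\in V$. For $n\ge1$, $C^n_{\beta,\alpha}(V,\mathfrak{g})$ is the space of linear maps $P:\wedge^nV\to\mathfrak{g}$ with $\alpha(P(v_1,\dots,v_n))=P(\beta(v_1),\dots,\beta(v_n))$, and $C^0_{\beta,\alpha}(V,\mathfrak{g})=\{x\in\mathfrak{g}\mid\alpha(x)=x\}$. With $\rho_T(v)(x)=[Tv,x]+T\{x,v\}$ and $[v,w]^c=\{Tv,w\}-\{Tw,v\}$, the differential is $\delta_{\beta,\alpha}(x)(v)=\rho_T(\beta^{-1}(v))(x)$ for $x\in C^0_{\beta,\alpha}(V,\mathfrak{g})$ and, for $P\in C^n_{\beta,\alpha}(V,\mathfrak{g})$, $n\ge1$, $$\delta_{\beta,\alpha}P(v_1,\dots,v_{n+1})=\sum_{i=1}^{n+1}(-1)^{i+1}\rho_T(\beta^{n-1}(v_i))\big(P(v_1,\dots,\widehat{v_i},\dots,v_{n+1})\big)+\sum_{i<j}(-1)^{i+j}P\big([v_i,v_j]^c,\beta(v_1),\dots,\widehat{\beta(v_i)},\dots,\widehat{\beta(v_j)},\dots,\beta(v_{n+1})\big).$$ $\widetilde{H}^*_{\beta,\alpha}(V,\mathfrak{g})$ is the cohomology of $\big(\bigoplus_{n\ge0}C^n_{\beta,\alpha}(V,\mathfrak{g}),\delta_{\beta,\alpha}\big)$. Extend $[\cdot,\cdot],\alpha,\rho,\beta$ to $\mathfrak{g}[[t]]$,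 $V[[t]]$ linearly over $k[[t]]$. A formal deformation of $T$ is $T_t=T_0+\sum_{i\ge1}t^iT_i$ with $T_0=T$, $T_i\in C^1_{\beta,\alpha}(V,\mathfrak{g})$, such that its $k[[t]]$-linear extension $V[[t]]\to\mathfrak{g}[[t]]$ is an $\mathcal{O}$-operator with respect to the extended structures. $T_1$ is the infinitesimal of $T_t$ (it is a $1$-cocycle). For $x\in C^0_{\beta,\alpha}(V,\mathfrak{g})$ put $\mathrm{ad}_x^\dagger(y)=\alpha^{-1}([x,y])$, $\rho(x)^\dagger(v)=\beta^{-1}(\rho(x)(v))$. Two formal deformations $T_t,\overline{T}_t$ of $T$ are equivalent if there exist $x\in C^0_{\beta,\alpha}(V,\mathfrak{g})$ and $k$-linear maps $\phi_i^{\mathfrak{g}}:\mathfrak{g}\to\mathfrak{g}$, $\phi_i^V:V\to V$ ($i\ge2$) such that, for $$\phi_t^{\mathfrak{g}}=\mathrm{Id}_{\mathfrak{g}}+t\,\mathrm{ad}_x^\dagger+\sum_{i\ge2}t^i\phi_i^{\mathfrak{g}},\qquad \phi_t^V=\mathrm{Id}_V+t\rho(x)^\dagger+\sum_{i\ge2}t^i\phi_i^V,$$ the pair $(\phi_t^{\mathfrak{g}},\phi_t^V)$ is a formal isomorphism from $T_t$ to $\overline{T}_t$, i.e. $\phi_t^{\mathfrak{g}}\circ T_t=\overline{T}_t\circ\phi_t^V$, $\phi_t^{\mathfrak{g}}[y,z]=[\phi_t^{\mathfrak{g}}(y),\phi_t^{\mathfrak{g}}(z)]$, $\rho(\phi_t^{\mathfrak{g}}(y))(\phi_t^V(v))=\phi_t^V(\rho(y)(v))$,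 $\phi_t^{\mathfrak{g}}\circ\alpha=\alpha\circ\phi_t^{\mathfrak{g}}$ and $\phi_t^V\circ\beta=\beta\circ\phi_t^V$ for all $y,z\in\mathfrak{g}$, $v\in V$. *)

(* Defs.v *)
From HB Require Import structures.
From mathcomp Require Import all_boot all_order all_algebra.
From mathcomp Require Import boolp classical_sets functions.

Set Implicit Arguments.
Unset Strict Implicit.
Unset Printing Implicit Defensive.

Import GRing.Theory.
Local Open Scope ring_scope.

(* The inverse of a bijection, extracted by the choice operator of A. *)
Section BijInverse.
Variables (A : choiceType) (B : eqType) (f : A -> B).

Lemma bij_exists (bf : bijective f) (y : B) : exists x, f x == y.
Proof. by case: bf => h _ hK; exists (h y); rewrite hK. Qed.

Definition bij_inv (bf : bijective f) (y : B) : A := xchoose (bij_exists bf y).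

Lemma bij_invK (bf : bijective f) : cancel f (bij_inv bf).
Proof. by move=> x; apply: (bij_inj bf); apply/eqP/(xchooseP (bij_exists bf _)). Qed.

Lemma bij_invKV (bf : bijective f) : cancel (bij_inv bf) f.
Proof. by move=> y; apply/eqP/(xchooseP (bij_exists bf y)). Qed.

End BijInverse.

Record homLie (k : fieldType) (g : lmodType k) := HomLie {
  hl_br : {bilinear g -> g -> g};
  hl_alpha : {linear g -> g};
  hl_skew : forall x y, hl_br x y = - hl_br y x;
  hl_alphaM : forall x y, hl_alpha (hl_br x y) = hl_br (hl_alpha x) (hl_alpha y);
  hl_jacobi : forall x y z,
    hl_br (hl_alpha x) (hl_br y z) + hl_br (hl_alpha y) (hl_br z x)
    + hl_br (hl_alpha z) (hl_br x y) = 0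
}.

Definition regular (k : fieldType) (g : lmodType k) (L : homLie g) : Prop :=
  bijective (hl_alpha L).

(* The linear map rho : g -> End(V) is given in curried form. *)
Record hlRep (k : fieldType) (g : lmodType k) (L : homLie g) (V : lmodType k) :=
  HlRep {
  rep_rho : {bilinear g -> V -> V};
  rep_beta : {linear V -> V};
  rep_equiv : forall x v,
    rep_rho (hl_alpha L x) (rep_beta v) = rep_beta (rep_rho x v);
  rep_br : forall x y v,
    rep_rho (hl_br L x y) (rep_beta v)
    = rep_rho (hl_alpha L x) (rep_rho y v) - rep_rho (hl_alpha L y) (rep_rho x v)
}.

(* The two identities of an O-operator, stated for additive groups so that they
   apply both to g, V and to g[[t]], V[[t]]; linearity is a separate matter. *)
Definition O_identities (g V : zmodType) (br : g -> g -> g) (alpha : g -> g)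
    (rho : g -> V -> V) (beta : V -> V) (T : V -> g) : Prop :=
  (forall v, T (beta v) = alpha (T v)) /\
  (forall u v, br (T u) (T v) = T (rho (T u) v - rho (T v) u)).

Definition O_operator (k : fieldType) (g : lmodType k) (L : homLie g)
    (V : lmodType k) (M : hlRep L V) (T : {linear V -> g}) : Prop :=
  O_identities (hl_br L) (hl_alpha L) (rep_rho M) (rep_beta M) T.

Section Cohomology.
Variables (k : fieldType) (g : lmodType k) (L : homLie g).
Variables (V : lmodType k) (M : hlRep L V) (T : {linear V -> g}).

Local Notation br := (hl_br L).
Local Notation alpha := (hl_alpha L).
Local Notation rho := (rep_rho M).
Local Notation beta := (rep_beta M).

Definition set_arg n (v : {ffun 'I_n -> V}) (i : 'I_n) (u : V) : {ffun 'I_n -> V} :=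
  [ffun j => if j == i then u else v j].

Definition multilinear n (P : {ffun 'I_n -> V} -> g) : Prop :=
  forall (v : {ffun 'I_n -> V}) i (a : k) u w,
    P (set_arg v i (a *: u + w)) = a *: P (set_arg v i u) + P (set_arg v i w).

Definition alternating n (P : {ffun 'I_n -> V} -> g) : Prop :=
  forall (v : {ffun 'I_n -> V}) i j, i != j -> v i = v j -> P v = 0.

(* Ambient space of n-cochains: g for n = 0, maps V^n -> g for n > 0. *)
Definition precochain (n : nat) : lmodType k :=
  if n is m.+1 then ({ffun 'I_m.+1 -> V} -> g : lmodType k) else g.

(* C^n(V, g); linear maps on the n-th exterior power of V are represented as
   alternating multilinear maps. *)
Definition cochain (n : nat) : set (precochain n) :=
  match n return precochain n -> Prop with
  | 0 => fun x => alpha x = x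
  | m.+1 => fun P => [/\ multilinear P, alternating P &
      forall v, alpha (P v) = P [ffun i => beta (v i)]]
  end.

Definition rhoT (v : V) (x : g) : g := br (T v) x + T (rho x v).

Definition brC (v w : V) : V := rho (T v) w - rho (T w) v.

(* The differential in degree m.+1.  Indices start at 0, so the sign of the
   i-th term of the first sum is (-1)^i. *)
Definition delta_pos (m : nat) (P : {ffun 'I_m.+1 -> V} -> g)
    (v : {ffun 'I_m.+2 -> V}) : g :=
  \sum_(i < m.+2)
     (-1) ^+ i *: rhoT (iter m beta (v i)) (P [ffun a => v (lift i a)])
  + \sum_(i < m.+2) \sum_(j < m.+2 | (i < j)%N)
     (-1) ^+ (i + j) *: P [ffun a : 'I_m.+1 =>
       nth 0 (brC (v i) (v j)
              :: [seq beta (v l) | l <- enum 'I_m.+2 & (l != i) && (l != j)]) a].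

Variable (bb : bijective beta).

Definition delta (n : nat) : precochain n -> precochain n.+1 :=
  match n return precochain n -> precochain n.+1 with
  | 0 => fun x v => rhoT (bij_inv bb (v ord0)) x
  | m.+1 => fun P => delta_pos P
  end.

Definition cocycle (n : nat) : set (precochain n) :=
  [set P | cochain P /\ delta P = 0].

Definition coboundary (n : nat) : set (precochain n) :=
  match n return set (precochain n) with
  | 0 => [set 0]
  | m.+1 => @delta m @` @cochain m
  end.

Definition coh_class (n : nat) (P : precochain n) : set (precochain n) :=
  [set Q | cocycle Q /\ coboundary (Q - P)].

(* H^n as the set of cosets of the coboundaries in the cocycles. *)
Definition cohomology (n : nat) : set (set (precochain n)) :=
  @coh_class n @` @cocycle n.

End Cohomology.

Arguments cochain {k g L V} M n.
Arguments cohomology {k g L V} M T bb n.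

(* A map V -> g seen as a precochain of degree 1. *)
Definition cochain1 (k : fieldType) (g V : lmodType k) (f : V -> g) :
  precochain g V 1 := fun v => f (v ord0).

(* U[[t]] is the group of coefficient sequences. *)
Notation "{ 'fps' U }" := (nat -> U) (at level 0, format "{ 'fps'  U }").

Definition fps_const (U : zmodType) (u : U) : {fps U} :=
  fun n => if n is 0 then u else 0.

Definition fps_map (U W : Type) (f : U -> W) (x : {fps U}) : {fps W} :=
  fun n => f (x n).

(* k[[t]]-bilinear extension of a bilinear map (Cauchy product). *)
Definition fps_bil (A B : Type) (C : zmodType) (m : A -> B -> C)
    (a : {fps A}) (b : {fps B}) : {fps C} :=
  fun n => \sum_(i < n.+1) m (a i) (b (n - i)%N).

(* k[[t]]-linear extension U[[t]] -> W[[t]] of phi = \sum_i t^i phi_i. *)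
Definition fps_app (k : fieldType) (U W : lmodType k)
    (phi : {fps {linear U -> W}}) (u : {fps U}) : {fps W} :=
  fps_bil (fun (f : {linear U -> W}) x => f x) phi u.

Section Deformations.
Variables (k : fieldType) (g : lmodType k) (L : homLie g).
Variables (V : lmodType k) (M : hlRep L V).

Local Notation br := (hl_br L).
Local Notation alpha := (hl_alpha L).
Local Notation rho := (rep_rho M).
Local Notation beta := (rep_beta M).

Definition formal_deformation (T : {linear V -> g})
    (Tt : {fps {linear V -> g}}) : Prop :=
  [/\ Tt 0%N =1 T,
      forall i, (0 < i)%N -> cochain M 1 (cochain1 (Tt i)) &
      O_identities (fps_bil br) (fps_map alpha) (fps_bil rho) (fps_map beta)
        (fps_app Tt)].

Definition formal_iso (phig : {fps {linear g -> g}}) (phiV : {fps {linear V -> V}})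
    (Tt Tt' : {fps {linear V -> g}}) : Prop :=
  let Phig := fps_app phig in
  let PhiV := fps_app phiV in
  [/\ forall v : V,
        Phig (fps_app Tt (fps_const v)) = fps_app Tt' (PhiV (fps_const v)),
      forall y z : g,
        Phig (fps_const (br y z))
        = fps_bil br (Phig (fps_const y)) (Phig (fps_const z)),
      forall (y : g) (v : V),
        fps_bil rho (Phig (fps_const y)) (PhiV (fps_const v))
        = PhiV (fps_const (rho y v)),
      forall y : g,
        Phig (fps_const (alpha y)) = fps_map alpha (Phig (fps_const y)) &
      forall v : V,
        PhiV (fps_const (beta v)) = fps_map beta (PhiV (fps_const v))].

Variables (ba : regular L) (bb : bijective beta).

Definition ad_dagger (x y : g) : g := bij_inv ba (br x y).

Definition rho_dagger (x : g) (v : V) : V := bij_inv bb (rho x v).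

Definition equivalent (Tt Tt' : {fps {linear V -> g}}) : Prop :=
  exists (x : g) (phig : {fps {linear g -> g}}) (phiV : {fps {linear V -> V}}),
    [/\ cochain M 0 x,
        phig 0%N =1 id /\ phiV 0%N =1 id,
        phig 1%N =1 ad_dagger x /\ phiV 1%N =1 rho_dagger x &
        formal_iso phig phiV Tt Tt'].

End Deformations.

Arguments formal_deformation {k g L V} M T Tt.
Arguments equivalent {k g L V} M ba bb Tt Tt'.

(* Main.v *)
(** The coefficient of [t] in the [O]-operator identity of [T_t] says that [T_1]
    is a 1-cocycle.  The coefficient of [t] in [phi^g_t T_t = T'_t phi^V_t] reads
    [T_1 - T'_1 = T rho(x)^dagger - ad_x^dagger T], and since [alpha x = x] and
    [T] intertwines [beta] with [alpha], the right-hand side is [delta x]. *)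

Require Import Defs.
From HB Require Import structures.
From mathcomp Require Import all_boot all_order all_algebra.
From mathcomp Require Import boolp classical_sets functions.

Set Implicit Arguments.
Unset Strict Implicit.
Unset Printing Implicit Defensive.

Local Open Scope ring_scope.

Import GRing.Theory.

Lemma fps_bil_coef1 (A B : Type) (C : zmodType) (m : A -> B -> C)
    (a : {fps A}) (b : {fps B}) :
  fps_bil m a b 1 = m (a 0) (b 1) + m (a 1) (b 0).
Proof. by rewrite /fps_bil !big_ord_recl big_ord0 addr0. Qed.

Lemma fps_bil_coef0 (A B : Type) (C : zmodType) (m : A -> B -> C)
    (a : {fps A}) (b : {fps B}) :
  fps_bil m a b 0 = m (a 0) (b 0).
Proof. by rewrite /fps_bil big_ord1. Qed.

Lemma fps_app_coef1 (k : fieldType) (U W : lmodType k)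
    (phi : {fps {linear U -> W}}) (u : {fps U}) :
  fps_app phi u 1 = phi 0 (u 1) + phi 1 (u 0).
Proof. exact: fps_bil_coef1. Qed.

Lemma fps_app_const (k : fieldType) (U W : lmodType k)
    (phi : {fps {linear U -> W}}) (u : U) (n : nat) :
  fps_app phi (fps_const u) n = phi n u.
Proof.
(* Only the last term sees the coefficient [u]: for [i < n] the index [n - i] is positive, and there
   [fps_const u] is [0]. *)
rewrite /fps_app /fps_bil big_ord_recr /= subnn big1 ?add0r // => i _.
by case E: (n - i)%N (subn_gt0 i n) => [|j] /=; rewrite ?ltn_ord // linear0.
Qed.

Section Infinitesimals.
Variables (k : fieldType) (g : lmodType k) (L : homLie g).
Variables (V : lmodType k) (M : hlRep L V) (T : {linear V -> g}).

Local Notation br := (hl_br L).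
Local Notation alpha := (hl_alpha L).
Local Notation rho := (rep_rho M).
Local Notation beta := (rep_beta M).

Lemma delta_pos_cochain1 (f : V -> g) (v : {ffun 'I_2 -> V}) :
  delta_pos M T (cochain1 f) v =
    rhoT M T (v ord0) (f (v ord_max)) - rhoT M T (v ord_max) (f (v ord0))
    - f (brC M T (v ord0) (v ord_max)).
Proof.
have lift01 : lift ord0 ord0 = ord_max :> 'I_2 by apply: val_inj.
have lift10 : lift ord_max ord0 = ord0 :> 'I_2 by apply: val_inj.
rewrite /delta_pos /cochain1 !big_ord_recl !big_ord0 !addr0 lift01.
(* The only pair [i < j] in ['I_2] is [(ord0, ord_max)], so the inner sum is one term for [i = 0]
   and empty for [i = 1]. *)
rewrite (big_pred1 (ord_max : 'I_2)); last by case=> [[|[|j]] hj].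
rewrite [X in _ + (_ + X)]big_pred0 ?addr0; last by case=> [[|[|j]] hj].
by rewrite !ffunE /= lift01 lift10 expr0 expr1 !scale1r !scaleN1r.
Qed.

Lemma deformation_order1 (Tt : {fps {linear V -> g}}) (u v : V) :
  formal_deformation M T Tt ->
  br (T u) (Tt 1 v) + br (Tt 1 u) (T v)
  = T (rho (Tt 1 u) v - rho (Tt 1 v) u) + Tt 1 (brC M T u v).
Proof.
case=> T0 _ [_ /(_ (fps_const u) (fps_const v))/(congr1 (fun s => s 1%N))].
rewrite fps_bil_coef1 !fps_app_const !T0 => ->.
have subE (a b : {fps V}) n : (a - b) n = a n - b n by [].
rewrite fps_app_coef1 T0 !subE !fps_bil_coef1 !fps_bil_coef0 !fps_app_const.
(* Constant series vanish at index 1, so the terms with [rho (T u)] and [rho (T v)] drop out of the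
   coefficient of [t] in the argument of [T_t]. *)
by rewrite /= !T0 !linear0r !add0r.
Qed.

Variable bb : bijective beta.

Lemma infinitesimal_cocycle (Tt : {fps {linear V -> g}}) :
  formal_deformation M T Tt -> cocycle T bb (n := 1) (cochain1 (Tt 1%N)).
Proof.
move=> hTt; split; first by case: hTt => _ + _; apply.
apply/funext => v; rewrite /= delta_pos_cochain1.
transitivity (0 : g) => //.
apply/eqP; rewrite subr_eq0; apply/eqP.
set u := v ord0; set w := v ord_max.
(* This summand completes the right-hand side to that of the order 1 identity; on the left it
   cancels the [T (rho _ _)] parts of the two [rhoT] terms. *)
apply: (addrI (T (rho (Tt 1%N u) w - rho (Tt 1%N w) u))).
rewrite -(deformation_order1 _ _ hTt) /rhoT (hl_skew L (T w)) linearB /=.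
rewrite [br (T u) _ + _]addrC opprD opprK !addrA subrK.
by rewrite addrAC [_ + br (T u) _]addrC addrK.
Qed.

Lemma delta0E (x : g) (v : V) (ba : regular L) :
  (forall v, T (beta v) = alpha (T v)) -> alpha x = x ->
  rhoT M T (bij_inv bb v) x = T (rho_dagger bb x v) - ad_dagger ba x (T v).
Proof.
(* Applying [alpha] removes every inverse: it cancels [alpha^-1] in [ad_dagger], and passes through
   [T] as [beta], cancelling [beta^-1]. Since [alpha x = x], both sides become
   [T (rho x v) - br x (T v)]. *)
move=> Tb ax; apply: (bij_inj ba).
rewrite linearB /= -Tb /ad_dagger /rho_dagger !bij_invKV /rhoT linearD /= -Tb.
rewrite hl_alphaM -rep_equiv -!Tb bij_invKV ax.
by rewrite (hl_skew L x) opprK addrC.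
Qed.

End Infinitesimals.

Theorem proposition4p9 (k : fieldType) (char0 : [pchar k] =i pred0)
    (g : lmodType k) (L : homLie g) (ba : regular L)
    (V : lmodType k) (M : hlRep L V) (bb : bijective (rep_beta M))
    (T : {linear V -> g}) (hT : O_operator M T)
    (Tt Tt' : {fps {linear V -> g}})
    (hTt : formal_deformation M T Tt) (hTt' : formal_deformation M T Tt')
    (heq : equivalent M ba bb Tt Tt') :
  exists2 c, cohomology M T bb 1 c &
    c (cochain1 (Tt 1%N)) /\ c (cochain1 (Tt' 1%N)).
Proof.
have cT := infinitesimal_cocycle bb hTt; have cT' := infinitesimal_cocycle bb hTt'.
(* With [T'_1] as representative, [T'_1] differs from it by [delta 0] and [T_1] by [delta x], where
   [x] is the element given by the equivalence. *)
exists (coh_class T bb (n := 1) (cochain1 (Tt' 1%N))); first by exists (cochain1 (Tt' 1%N)).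
split; split=> //; last first.
  exists 0; first exact: linear0.
  by apply/funext => v; rewrite subrr /= /rhoT !linear0r linear0l linear0 addr0.
case: heq => x [phig [phiV [ax [g0 V0] [g1 V1] [iso _ _ _ _]]]].
exists x => //; apply/funext => v.
case: hTt hTt' hT => T0 _ _ [T0' _ _] [Tb _].
rewrite /= (delta0E _ _ ba Tb ax).
have /(congr1 (fun s => s 1%N)) := iso (v ord0).
rewrite !fps_app_coef1 !fps_app_const.
rewrite /= g0 !V0 g1 V1 !T0 !T0' !linear0 !add0r => E.
rewrite -[RHS]/(Tt 1%N (v ord0) - Tt' 1%N (v ord0)).
by apply/eqP; rewrite subr_eq addrAC E addrK.
Qed.
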